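(* Let $n\ge 1$ and let $x_1,\dots,x_n,\lambda$ be indeterminates. Then \[\prod_{1\le i<j\le n}(x_i+\lambda x_j)=\sum_{\alpha\in Y_n(\{b,y,o,g\})}\lambda^{E(\alpha)}(1+\lambda)^{N(\alpha)}\prod_{k=1}^n x_k^{C_k(\alpha)-1}.\]
   Context: $Y_n(\{b,y,o,g\})$ is the set of integer arrays $\alpha=(\alpha_{i,j})$, $1\le i\le n$, $0\le j\le n-i$, with $i\le\alpha_{i,j}\le i+j$ and, whenever the entries involved are defined, $\alpha_{i,j}<\alpha_{i+1,j}$, $\alpha_{i,j}\le\alpha_{i,j+1}$, and $\alpha_{i,j}\le\alpha_{i+1,j-1}$. For an entry $\alpha_{i,j}$ with $j\ge1$, its southwest diagonal neighbor is $\alpha_{i+1,j-1}$ and its west neighbor is $\alpha_{i,j-1}$. $E(\alpha)$ is the number of entries $\alpha_{i,j}$ ($j\ge 1$) equal to their southwest diagonal neighbor; $N(\alpha)$ is the number of entries ($j\ge1$) strictly greater than their west neighbor and strictly less than their southwest diagonal neighbor; $C_k(\alpha)$ is the total number of entries of $\alpha$ (including column $0$) equal to $k$. *)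

(* Defs.v *)
(* MathComp + multinomials. *)
From mathcomp Require Import all_boot all_order all_algebra.
From mathcomp Require Export mpoly.

Set Implicit Arguments.
Unset Strict Implicit.
Unset Printing Implicit Defensive.

Import GRing.Theory.

(* Positions (i, j) with 1 <= i <= n and 0 <= j <= n - i.  Both coordinates
   keep their mathematical values: rows start at 1, columns at 0. *)
Definition cell (n : nat) : Type :=
  {p : 'I_n.+1 * 'I_n.+1 | (0 < p.1) && (p.1 + p.2 <= n)}.

Definition cell_row n (p : cell n) : nat := (val p).1.
Definition cell_col n (p : cell n) : nat := (val p).2.

(* [is_below p q]: q is the cell (i + 1, j) when p is the cell (i, j), and
   similarly for (i, j - 1) and (i + 1, j - 1) in the next two.  In the last
   two the equation on columns forces 1 <= j. *)
Definition is_below n (p q : cell n) : bool :=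
  (cell_row q == (cell_row p).+1) && (cell_col q == cell_col p).
Definition is_west n (p q : cell n) : bool :=
  (cell_row q == cell_row p) && (cell_col p == (cell_col q).+1).
Definition is_southwest n (p q : cell n) : bool :=
  (cell_row q == (cell_row p).+1) && (cell_col p == (cell_col q).+1).

(* Entries are stored in {0, ..., n}.  This loses no integer array of
   [Ybyog n], since there 1 <= i <= alpha_{i,j} <= i + j <= n. *)
Definition array (n : nat) : Type := {ffun cell n -> 'I_n.+1}.

Definition Ybyog (n : nat) : {set array n} :=
  [set a : array n |
    [&& [forall p : cell n, cell_row p <= a p <= cell_row p + cell_col p],
        [forall p : cell n, forall q : cell n, is_below p q ==> (a p < a q)],
        [forall p : cell n, forall q : cell n, is_west p q ==> (a q <= a p)]
      & [forall p : cell n, forall q : cell n,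
           is_southwest p q ==> (a p <= a q)]]].

Definition statE n (a : array n) : nat :=
  #|[set p : cell n | [exists q : cell n, is_southwest p q && (a p == a q)]]|.

Definition statN n (a : array n) : nat :=
  #|[set p : cell n |
      [exists q : cell n, is_west p q && (a q < a p)] &&
      [exists q : cell n, is_southwest p q && (a p < a q)]]|.

Definition statC n (k : nat) (a : array n) : nat :=
  #|[set p : cell n | a p == k :> nat]|.

(* The n + 1 indeterminates lambda, x_1, ..., x_n are the variables of index
   0, 1, ..., n; [xvar] is only meant for k != 0. *)
Definition lam (n : nat) : {mpoly int[n.+1]} := 'X_ord0.
Definition xvar (n : nat) (k : 'I_n.+1) : {mpoly int[n.+1]} := 'X_k.

(* Main.v *)
(* Read by columns, an array of [Ybyog n] is a monotone triangle with bottom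
   row 1, ..., n: column j + 1 interlaces column j.  For an increasing sequence
   s_0 < ... < s_(m-1), the weighted sum over the monotone triangles with bottom
   row s is prod_i x_(s_i) times det (p_j(s_i)), where p_0 = 1 and
     p_(j+1)(v) = (1 + l) * sum_(c < v) x_c p_j(c) + l * x_v p_j(v).
   Indeed the weights of an entry c in the interval [a, b] (1 at a, l at b, 1 + l
   inside) make the weighted sum of x_c p_j(c) equal to p_(j+1)(b) - p_(j+1)(a),
   so the removal of the bottom row is multilinearity of the determinant.  The
   interlacing rows that are not strictly increasing repeat an entry and
   contribute a zero determinant.

   For s = (1, ..., n) the columns of the matrix are 1, A 1, A^2 1, ... for a
   triangular matrix A with eigenvalues l x_i.  The left eigenvectors of A form a
   triangular matrix U whose product with it is a Vandermonde matrix in the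
   l x_i, up to the factors prod_(k < i) (x_k + l x_i) on the rows, while det U
   is the same Vandermonde determinant, which cancels. *)
Require Import Defs.
From mathcomp Require Import all_boot all_order all_algebra.
From mathcomp Require Import mpoly.
From mathcomp Require Import ring zify.

Set Implicit Arguments.
Unset Strict Implicit.
Unset Printing Implicit Defensive.

Import GRing.Theory.
Local Open Scope ring_scope.

(** * Krylov vectors and removal of the bottom row of a determinant *)

Section Krylov.
Variables (R : comNzRingType) (l : R) (x : nat -> R).

Fixpoint krylov (j v : nat) : R :=
  if j is j'.+1 then
    \sum_(c < v) (1 + l) * (x c * krylov j' c) + l * (x v * krylov j' v)
  else 1.

Definition entry_wt (a b c : nat) : R := l ^+ (c == b) * (1 + l) ^+ (a < c < b).

(** In the difference on the right, the index [a] gets the coefficient [(1 + l) - l = 1], the index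
    [b] gets [l], and those strictly between get [1 + l]. *)
Lemma sum_wt_krylov N j a b : (a < b <= N)%N ->
  \sum_(c < N.+1) (a <= c <= b)%N%:R * (entry_wt a b c * (x c * krylov j c)) =
  krylov j.+1 b - krylov j.+1 a.
Proof.
move=> /andP[ab bN].
rewrite -(big_mkord xpredT (fun c => (a <= c <= b)%N%:R * (entry_wt a b c * (x c * krylov j c)))).
rewrite (big_cat_nat _ (n := a)) //=; last lia.
rewrite big1_seq ?add0r; last first.
  move=> c; rewrite mem_index_iota => /andP[_ /andP[_ ca]].
  by rewrite (leqNgt a) ca /= mul0r.
rewrite (big_cat_nat _ (n := b.+1)) /=; [|lia|lia].
rewrite [X in _ + X]big1_seq ?addr0; last first.
  move=> c; rewrite mem_index_iota => /andP[_ /andP[bc _]].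
  by rewrite (leqNgt c b) bc andbF mul0r.
rewrite big_ltn; last lia.
rewrite big_nat_recr //= leqnn (ltnW ab) /= !mul1r {1}/entry_wt.
rewrite (ltn_eqF ab) ltnn expr0 expr0 !mul1r leqnn /=.
rewrite -(big_mkord xpredT (fun c => (1 + l) * (x c * krylov j c))).
rewrite (big_cat_nat _ (m := 0) (n := a.+1)) //=.
rewrite (big_nat_recr a 0) //= big_mkord.
rewrite {2}/entry_wt eqxx ltnn andbF expr1 expr0 mulr1 /= mul1r.
suff -> : \sum_(a.+1 <= i < b) (a <= i <= b)%:R * (entry_wt a b i * (x i * krylov j i)) =
   \sum_(a.+1 <= i < b) (1 + l) * (x i * krylov j i) by ring.
apply: eq_big_nat => c /andP[ac cb].
by rewrite (ltnW ac) (ltnW cb) mul1r /entry_wt (ltn_eqF cb) ac cb expr0 expr1 mul1r.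
Qed.

Definition krylovmx m (s : nat -> nat) : 'M[R]_m := \matrix_(i, j) krylov j (s i).

(** [A] is the all-ones lower triangular matrix times [D], which keeps row 0 and has consecutive row
    differences below it. The first column of [D] is the first basis vector, so the determinant
    expands along it. *)
Lemma det_rowdiff m (A : 'M[R]_m.+1) : (forall i, A i 0 = 1) ->
  \det A = \det (\matrix_(i < m, j < m)
     (A (lift 0 i) (lift 0 j) - A (widen_ord (leqnSn m) i) (lift 0 j))).
Proof.
move=> A0.
pose D := \matrix_(i < m.+1, j < m.+1)
   (A i j - if unlift 0 i is Some i' then A (widen_ord (leqnSn m) i') j else 0).
pose L : 'M[R]_m.+1 := \matrix_(i, k) (k <= i)%N%:R.
have AE : A = L *m D.
  apply/matrixP => i j; rewrite mxE.
  pose f k := A (inord k) j; pose g k := if k is k1.+1 then f k1 else 0.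
  have -> : \sum_k L i k * D k j = \sum_(k < m.+1 | (k <= i)%N) (f k - g k).
    rewrite [RHS]big_mkcond; apply: eq_bigr => k _; rewrite !mxE.
    case: (k <= i)%N; rewrite ?mul0r ?mul1r //.
    congr (_ - _); first by rewrite /f inord_val.
    case: unliftP => [k' ->|-> //].
    by rewrite /g lift0 /= /f; congr (A _ j); apply/val_inj; rewrite /= inordK // ltnS ltnW.
  transitivity (\sum_(0 <= k < i.+1) (f k - g k)); last first.
    by rewrite (big_nat_widen 0 i.+1 m.+1) // big_mkord.
  rewrite big_nat_recl //= subr0.
  rewrite telescope_sumr // /f addrC subrK; congr (A _ j); exact/esym/inord_val.
rewrite {1}AE det_mulmx det_trig; last first.
  by apply/is_trig_mxP => i j ij; rewrite mxE leqNgt ij.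
rewrite big1 ?mul1r; last by move=> i _; rewrite mxE leqnn.
rewrite (expand_det_col _ 0) big_ord_recl big1 ?addr0.
  rewrite mxE unlift_none subr0 A0 mul1r /cofactor expr0 mul1r; congr (\det _).
  by apply/matrixP=> i j; rewrite !mxE liftK.
by move=> i _; rewrite mxE liftK !A0 subrr mul0r.
Qed.

(** Multilinearity in the rows, with every choice [t] of summands expanded at once. *)
Lemma det_sum_rows m (I : finType) (F : 'I_m -> I -> R) (G : I -> 'I_m -> R) :
  \det (\matrix_(i, j) \sum_c F i c * G c j) =
  \sum_(t : {ffun 'I_m -> I}) (\prod_i F i (t i)) * \det (\matrix_(i, j) G (t i) j).
Proof.
under [RHS]eq_bigr => t _ do rewrite big_distrr.
rewrite exchange_big; apply: eq_bigr => /= s _.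
under eq_bigr => i _ do rewrite mxE.
rewrite bigA_distr_bigA /= big_distrr; apply: eq_bigr => t _.
rewrite big_split /= mulrCA; congr (_ * (_ * _)).
by apply: eq_bigr => i _; rewrite mxE.
Qed.

(** After row differences, entry [(i, j)] is the increment of [krylov j.+1] from [s i] to [s i.+1],
    hence a weighted sum over that interval. *)
Lemma det_krylovmx_rec N m (s : nat -> nat) :
  (forall i, i < m -> s i < s i.+1 <= N)%N ->
  \det (krylovmx m.+1 s) = \sum_(t : {ffun 'I_m -> 'I_N.+1})
    (\prod_(i < m) ((s i <= t i <= s i.+1)%N%:R * (entry_wt (s i) (s i.+1) (t i) * x (t i)))) *
    \det (\matrix_(i < m, j < m) krylov j (t i)).
Proof.
move=> sP; rewrite det_rowdiff; last by move=> i; rewrite mxE.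
rewrite -(det_sum_rows
  (fun (i : 'I_m) (c : 'I_N.+1) =>
     ((s i <= c <= s i.+1)%N%:R * (entry_wt (s i) (s i.+1) c * x c)))
  (fun (c : 'I_N.+1) (j : 'I_m) => krylov j c)).
congr (\det _); apply/matrixP => i j; rewrite !mxE lift0.
rewrite -(@sum_wt_krylov N j) ?sP //=.
by apply: eq_bigr => c _; rewrite !mulrA.
Qed.

End Krylov.

(** * Evaluation of the determinant by left eigenvectors *)

Section KrylovEval.
Variables (R : idomainType) (l : R) (x : nat -> R).

(* [eigtail i c] is the sum of the entries of index >= c of the left eigenvector
   for the eigenvalue [l * x i], which is supported on the indices <= i. *)
Definition eigtail (i c : nat) : R :=
  if (c <= i)%N then
    \prod_(0 <= k < c) (l * x i - l * x k) * \prod_(c <= k < i) (x k + l * x i)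
  else 0.

(** The eigenvector equation in terms of tail sums; at [c = i] both sides vanish, which is where the
    support ends. *)
Lemma eigtail_rec i c : (l * x i - l * x c) * eigtail i c = (x c + l * x i) * eigtail i c.+1.
Proof.
rewrite /eigtail; case: (ltngtP c i) => [ci|ci|->].
- rewrite [X in _ * (_ * X)]big_ltn // big_nat_recr //=; ring.
- by rewrite !mulr0.
- by rewrite subrr mul0r mulr0.
Qed.

(** Truncating the eigenvector relation at [M] leaves a boundary term, which carries the induction
    on [M] and vanishes once [M > i]. *)
Lemma sum_eigtail_krylovS i j M :
  \sum_(c < M) (eigtail i c - eigtail i c.+1) * krylov l x j.+1 c =
  l * x i * (\sum_(c < M) (eigtail i c - eigtail i c.+1) * krylov l x j c) -
  eigtail i M * \sum_(c < M) (1 + l) * (x c * krylov l x j c).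
Proof.
elim: M => [|M IH]; first by rewrite !big_ord0 !mulr0 subr0.
rewrite 3!big_ord_recr /= IH.
move: (eigtail_rec i M) (\sum_(c < M) (1 + l) * _) => E S.
apply/eqP; rewrite -subr_eq0.
set D := (X in X == 0).
have -> : D = krylov l x j M *
    ((x M + l * x i) * eigtail i M.+1 - (l * x i - l * x M) * eigtail i M).
  rewrite /D; ring.
by rewrite E subrr mulr0.
Qed.

(** For [j = 0] the sum telescopes to [eigtail i 0]; each increment of [j] contributes the
    eigenvalue. *)
Lemma sum_eigtail_krylov n i j : (i < n)%N ->
  \sum_(c < n) (eigtail i c - eigtail i c.+1) * krylov l x j c =
  (l * x i) ^+ j * \prod_(k < i) (x k + l * x i).
Proof.
move=> ltin; have eigtail_n : eigtail i n = 0 by rewrite /eigtail leqNgt ltin.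
elim: j => [|j IH]; last first.
  by rewrite sum_eigtail_krylovS eigtail_n mul0r subr0 IH exprS mulrA.
under eq_bigr do rewrite mulr1 -opprB.
rewrite sumrN -(big_mkord xpredT (fun c => eigtail i c.+1 - eigtail i c)) telescope_sumr //.
by rewrite eigtail_n sub0r opprK /eigtail leq0n big_geq // mul1r expr0 mul1r big_mkord.
Qed.

Lemma det_krylovmx n :
  l != 0 -> (forall i j, (i < j < n)%N -> x i != x j) ->
  \det (krylovmx l x n id) =
  \prod_(j < n) \prod_(i < n | (i < j)%N) (x i + l * x j).
Proof.
move=> l0 xinj.
pose U : 'M[R]_n := \matrix_(i, c) (eigtail i c - eigtail i c.+1).
pose V : 'M[R]_n := Vandermonde n (\row_i (l * x i)).
pose P i := \prod_(k < i) (x k + l * x i).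
have UK : U *m krylovmx l x n id = diag_mx (\row_i P i) *m V^T.
  apply/matrixP => i j; rewrite mul_diag_mx !mxE mulrC -(@sum_eigtail_krylov n) //.
  by apply: eq_bigr => c _; rewrite !mxE.
(* [U] is lower triangular with diagonal entries [eigtail i i], the product of [l * x i - l * x k]
   over [k < i]. *)
have detU : \det U = \det V.
  rewrite det_trig; last first.
    apply/is_trig_mxP => i j ij; rewrite mxE /eigtail.
    by rewrite [(j <= i)%N]leqNgt ij ltnNge (ltnW ij) subrr.
  rewrite det_Vandermonde (exchange_big_dep xpredT) //=; apply: eq_bigr => i _.
  rewrite [LHS]mxE /eigtail leqnn ltnn subr0 [X in _ * X]big_geq // mulr1 big_mkord.
  rewrite (big_ord_widen n (fun k => l * x i - l * x k)) ?(ltnW (ltn_ord i)) //.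
  by apply: eq_bigr => k _; rewrite !mxE.
have V0 : \det V != 0.
  rewrite det_Vandermonde; apply/prodf_neq0 => i _; apply/prodf_neq0 => j ij.
  by rewrite !mxE -mulrBr mulf_neq0 // subr_eq0 eq_sym xinj // ij /=.
apply: (mulfI V0); rewrite -{1}detU -det_mulmx UK det_mulmx det_diag det_tr mulrC.
congr (_ * _); apply: eq_bigr => i _; rewrite mxE /P.
by rewrite (big_ord_widen n (fun k => x k + l * x i)) // ltnW.
Qed.
End KrylovEval.

(** * Monotone triangles with a prescribed bottom row, and their weighted sum *)

Lemma cell_inj m (p q : cell m) :
  cell_row p = cell_row q -> cell_col p = cell_col q -> p = q.
Proof.
by case: p q => [[i j] ?] [[i' j'] ?] /= ii jj; apply/val_inj; congr (_, _); apply/val_inj.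
Qed.

Lemma cell_exists m i j : (i.+1 + j <= m)%N ->
  exists p : cell m, cell_row p = i.+1 /\ cell_col p = j.
Proof.
move=> ijm; have im : (i.+1 < m.+1)%N by lia.
have jm : (j < m.+1)%N by lia.
by exists (exist _ (Ordinal im, Ordinal jm) ijm).
Qed.

Lemma cell_range m (p : cell m) : (0 < cell_row p)%N && (cell_row p + cell_col p <= m)%N.
Proof. exact: valP p. Qed.

Section Triangles.
Variable N : nat.
Definition tri m : Type := {ffun cell m -> 'I_N.+1}.

(* Rows of [entry] are counted from 0, whereas [cell_row] starts at 1; outside
   the triangle it returns [ord0]. *)
Definition entry m (a : tri m) (i j : nat) : 'I_N.+1 :=
  if [pick p : cell m | (cell_row p == i.+1) && (cell_col p == j)] is Some p
  then a p else ord0.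

Lemma entryE m (a : tri m) (p : cell m) : a p = entry a (cell_row p).-1 (cell_col p).
Proof.
rewrite /entry; case: pickP => [q /andP[/eqP qr /eqP qc]|/(_ p)].
  congr (a _); apply: cell_inj; rewrite ?qr ?qc // prednK //.
  by case/andP: (cell_range p).
by rewrite prednK ?eqxx //; case/andP: (cell_range p).
Qed.

Definition mktri m (f : nat -> nat -> 'I_N.+1) : tri m :=
  [ffun p => f (cell_row p).-1 (cell_col p)].

Lemma entry_mktri m f i j : (i + j < m)%N -> entry (mktri m f) i j = f i j.
Proof.
move=> /cell_exists[p [pr pc]].
by have := entryE (mktri m f) p; rewrite ffunE pr pc.
Qed.

Lemma eq_tri m (a b : tri m) :
  (forall i j, i + j < m -> entry a i j = entry b i j)%N -> a = b.
Proof.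
move=> ab; apply/ffunP => p; rewrite !entryE; apply: ab.
by have := cell_range p; lia.
Qed.

(** The conditions of [Ybyog] without the bounds on the entries, so that column 0 may be any
    increasing sequence. *)
Definition monotone m (a : tri m) : bool :=
  [&& [forall p : cell m, forall q : cell m, is_below p q ==> (a p < a q)%N],
      [forall p : cell m, forall q : cell m, is_west p q ==> (a q <= a p)%N]
    & [forall p : cell m, forall q : cell m, is_southwest p q ==> (a p <= a q)%N]].

Lemma monotoneP m (a : tri m) :
  reflect (forall i j, i.+1 + j < m -> entry a i j < entry a i.+1 j /\
             entry a i j <= entry a i j.+1 <= entry a i.+1 j)%N (monotone a).
Proof.
apply: (iffP and3P) => [[/forallP b /forallP w /forallP s] i j ijm|H].
  have [p [pr pc]] : exists p : cell m, cell_row p = i.+1 /\ cell_col p = j by apply: cell_exists; lia.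
  have [q [qr qc]] : exists p : cell m, cell_row p = i.+2 /\ cell_col p = j by apply: cell_exists; lia.
  have [r [rr rc]] : exists p : cell m, cell_row p = i.+1 /\ cell_col p = j.+1 by apply: cell_exists; lia.
  move: (forallP (b p) q) (forallP (w r) p) (forallP (s r) q).
  rewrite /is_below /is_west /is_southwest !entryE pr pc qr qc rr rc !eqxx /=.
  by move=> -> -> ->.
split; apply/forallP => p; apply/forallP => q; apply/implyP => /andP[/eqP r /eqP c];
  rewrite !entryE; have := cell_range p; have := cell_range q; rewrite r c.

- by case: (cell_row p) => [|i] //= ? ?; case: (H i (cell_col p)) => //; lia.
- by case: (cell_row p) => [|i] //= ? ?; case: (H i (cell_col q)) => [|_ /andP[]//]; lia.
- by case: (cell_row p) => [|i] //= ? ?; case: (H i (cell_col q)) => [|_ /andP[]//]; lia.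
Qed.

Definition add_base m (s : nat -> 'I_N.+1) (b : tri m) : tri m.+1 :=
  mktri m.+1 (fun i j => if j is j'.+1 then entry b i j' else s i).

Definition drop_base m (a : tri m.+1) : tri m := mktri m (fun i j => entry a i j.+1).

Definition base_row m (a : tri m) : {ffun 'I_m -> 'I_N.+1} := [ffun i : 'I_m => entry a i 0].

(** Gives a row the type [nat -> 'I_N.+1] under which the induction of [sum_monotone] takes its
    base. *)
Definition extend m (t : {ffun 'I_m -> 'I_N.+1}) (i : nat) : 'I_N.+1 :=
  oapp t ord0 (insub i).

Lemma extendE m (t : {ffun 'I_m -> 'I_N.+1}) (i : 'I_m) : extend t i = t i.
Proof. by rewrite /extend valK. Qed.

Lemma entry_add_base0 m s (b : tri m) i : (i < m.+1)%N -> entry (add_base s b) i 0 = s i.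
Proof. by move=> im; rewrite entry_mktri ?addn0. Qed.

Lemma entry_add_baseS m s (b : tri m) i j : (i + j < m)%N ->
  entry (add_base s b) i j.+1 = entry b i j.
Proof. by move=> im; rewrite entry_mktri // addnS. Qed.

(** The only new conditions relate columns 0 and 1, where they say interlacing; the strict increase
    of column 0 is the hypothesis on [s]. *)
Lemma monotone_add_base m (s : nat -> 'I_N.+1) (b : tri m) :
  (forall i, i < m -> s i < s i.+1)%N ->
  monotone (add_base s b) = monotone b && [forall i : 'I_m, s i <= base_row b i <= s i.+1]%N.
Proof.
move=> sP; apply/monotoneP/andP => [H|[/monotoneP H /forallP B]].
  split; last first.
    apply/forallP => i; have [|_] := H i 0%N; first by rewrite addn0 ltnS.
    by rewrite !entry_add_base0 ?entry_add_baseS ?addn0 ?ltnS ?ffunE // ltnW.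
  apply/monotoneP => i j ijm; have [|] := H i j.+1; first lia.
  by rewrite !entry_add_baseS //; lia.
move=> i [|j] ijm.
  have im : (i < m)%N by lia.
  have := B (Ordinal im).
  by rewrite !entry_add_base0 ?entry_add_baseS ?addn0 ?ltnS ?ffunE ?sP // ltnW.
have [|] := H i j; first lia.
by rewrite !entry_add_baseS //; lia.
Qed.

Variables (R : comNzRingType) (l : R) (x : nat -> R).

(** Each entry [f i j.+1] is weighted against its west neighbor [f i j] and its southwest neighbor
    [f i.+1 j]. *)
Definition tri_wt m (f : nat -> nat -> nat) : R :=
  (\prod_(j < m) \prod_(i < m - j) x (f i j)) *
  \prod_(j < m) \prod_(i < m - j.+1) entry_wt l (f i j) (f i.+1 j) (f i j.+1).

Lemma eq_tri_wt m f g : (forall i j, i + j < m -> f i j = g i j)%N -> tri_wt m f = tri_wt m g.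
Proof.
move=> fg; rewrite /tri_wt; congr (_ * _); apply: eq_bigr => j _; apply: eq_bigr => i _.
  by rewrite fg //; have := ltn_ord i; lia.
by rewrite !fg //; have := ltn_ord i; lia.
Qed.

Lemma tri_wt_add_base m (s : nat -> 'I_N.+1) (b : tri m) :
  tri_wt m.+1 (entry (add_base s b)) =
  (\prod_(i < m.+1) x (s i)) *
  (\prod_(i < m) entry_wt l (s i) (s i.+1) (base_row b i)) * tri_wt m (entry b).
Proof.
rewrite (@eq_tri_wt _ _ (fun i j => if j is j'.+1 then entry b i j' else s i)); last first.
  by move=> i [|j] ijm; rewrite entry_mktri.
rewrite /tri_wt big_ord_recl [X in _ * X = _]big_ord_recl /= subn0 subn1 /=.
under [\prod_(i < m) entry_wt _ _ _ (base_row b i)]eq_bigr do rewrite ffunE.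
by rewrite mulrACA.
Qed.

Lemma add_baseK m s (a : tri m.+1) :
  (add_base s (drop_base a) == a) = [forall i : 'I_m.+1, entry a i 0 == s i].
Proof.
apply/eqP/forallP => [<- i|H].
  by rewrite entry_add_base0.
apply: eq_tri => i [|j]; last first.
  by move=> ijm; rewrite entry_add_baseS ?entry_mktri //; lia.
by rewrite addn0 => im; rewrite entry_add_base0 // (eqP (H (Ordinal im))).
Qed.

Lemma drop_add_base m s (b : tri m) : drop_base (add_base s b) = b.
Proof. by apply: eq_tri => i j ijm; rewrite entry_mktri // entry_add_baseS. Qed.

Lemma sum_monotone m (s : nat -> 'I_N.+1) : (forall i, i.+1 < m -> s i < s i.+1)%N ->
  \sum_(a : tri m | monotone a && [forall i : 'I_m, entry a i 0 == s i]) tri_wt m (entry a) =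
  (\prod_(i < m) x (s i)) * \det (krylovmx l x m s).
Proof.
elim: m s => [|m IH] s sP.
  rewrite big_ord0 det_mx00 mulr1 (big_pred1 (mktri 0 (fun _ _ => ord0))).
    by rewrite /tri_wt !big_ord0 mulr1.
  move=> a; rewrite [RHS](_ : _ = true); last by apply/eqP/eq_tri.
  by apply/andP; split; [apply/monotoneP|apply/forallP; case].
rewrite (reindex_onto (add_base s) (@drop_base m)); last first.
  by move=> a /andP[_]; rewrite -add_baseK => /eqP.
transitivity (\sum_(b : tri m | monotone b && [forall i : 'I_m, s i <= base_row b i <= s i.+1]%N)
    tri_wt m.+1 (entry (add_base s b))).
  apply: eq_bigl => b; rewrite drop_add_base eqxx andbT monotone_add_base //.
  by rewrite andb_idr // => _; apply/forallP => i; rewrite entry_add_base0.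
rewrite (partition_big (@base_row m) xpredT) //=.
rewrite (@det_krylovmx_rec _ l x N); last first.
  by move=> i im; rewrite sP //= -ltnS.
rewrite big_distrr; apply: eq_bigr => t _ /=.
have [st|] := boolP [forall i : 'I_m, s i <= t i <= s i.+1]%N; last first.
  move=> /forallPn /= [i /negbTE Hi].
  rewrite (bigD1 i) //= Hi !mul0r mulr0 big_pred0 // => b.
  apply/negbTE/negP => /andP[/andP[_ /forallP H] /eqP bt].
  by have := H i; rewrite bt Hi.
transitivity (\sum_(b : tri m | monotone b && [forall i : 'I_m, entry b i 0 == extend t i])
   (\prod_(i < m.+1) x (s i)) *
  (\prod_(i < m) entry_wt l (s i) (s i.+1) (t i)) * tri_wt m (entry b)).
  apply: eq_big => [b|b /andP[_ /eqP <-]]; last by rewrite tri_wt_add_base.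
  rewrite -andbA; congr (_ && _); apply/andP/forallP => [[_ /eqP <-] i|H].
    by rewrite extendE ffunE.
  have -> : base_row b = t by apply/ffunP => i; rewrite ffunE -extendE; apply/eqP.
  by [].
rewrite -big_distrr /= -mulrA; congr (_ * _).
have -> : \prod_(i < m) ((s i <= t i <= s i.+1)%N%:R *
      (entry_wt l (s i) (s i.+1) (t i) * x (t i))) =
    (\prod_(i < m) entry_wt l (s i) (s i.+1) (t i)) * \prod_(i < m) x (t i).
  by rewrite -big_split; apply: eq_bigr => i _; rewrite (forallP st i) mul1r.
rewrite -mulrA; congr (_ * _).
(* Interlacing makes [t] only weakly increasing, while the induction hypothesis needs a strict
   increase. *)
have [tinc|] := boolP [forall i : 'I_m, forall j : 'I_m, (i.+1 == j) ==> (t i < t j)%N].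
  rewrite (IH (extend t)); last first.
    move=> i im; have im' : (i < m)%N by apply: ltnW.
    have := forallP (forallP tinc (Ordinal im')) (Ordinal im).
    by rewrite eqxx /= -!extendE.
  rewrite (_ : krylovmx _ _ _ _ = \matrix_(i, j) krylov l x j (t i)).
    by under eq_bigr do rewrite extendE.
  by apply/matrixP => i j; rewrite !mxE extendE.
move=> /forallPn[i /forallPn[j]]; rewrite negb_imply => /andP[/eqP ij tij].
(* Interlacing gives [t i <= s j <= t j], so the two entries agree: no monotone triangle has this
   base, and the determinant has two equal rows. *)
have tij_eq : t i = t j.
  apply/val_inj/eqP; rewrite eqn_leq [(t j <= t i)%N]leqNgt tij andbT /=.
  have /andP[_ h1] := forallP st i; have /andP[h2 _] := forallP st j.
  by apply: leq_trans h1 _; rewrite ij.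
rewrite big_pred0; last first.
  move=> b; apply/negbTE/negP => /andP[/monotoneP H /forallP B].
  have [|] := H i 0%N; first by rewrite ij addn0.
  by rewrite ij (eqP (B i)) (eqP (B j)) !extendE tij_eq ltnn.
rewrite (@determinant_alternate _ _ _ i j) ?mulr0 //.
  by apply/eqP => /(congr1 val) /=; rewrite -ij => /eqP; rewrite eqn_leq ltnn andbF.
by move=> k; rewrite !mxE tij_eq.
Qed.
End Triangles.

(** * Products over cells and the statistics E and N *)

Lemma prod_ord_gt0 (R : comNzRingType) n (P : pred 'I_n.+1) (F : 'I_n.+1 -> R) :
  ~~ P ord0 -> \prod_(i | P i) F i = \prod_(i < n | P (lift ord0 i)) F (lift ord0 i).
Proof.
move=> /negbTE P0.
by rewrite big_mkcond big_ord_recl P0 /= mul1r [RHS]big_mkcond.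
Qed.

Lemma prod_cell (R : comNzRingType) m (F : nat -> nat -> R) :
  \prod_(p : cell m) F (cell_row p).-1 (cell_col p) =
  \prod_(j < m) \prod_(i < m - j) F i j.
Proof.
transitivity (\prod_(p : 'I_m.+1 * 'I_m.+1 | (0 < p.1)%N && (p.1 + p.2 <= m)%N) F p.1.-1 p.2).
  exact: esym (big_sub (fun p : 'I_m.+1 * 'I_m.+1 => (0 < p.1)%N && (p.1 + p.2 <= m)%N)
    (fun p => F p.1.-1 p.2)).
rewrite -(pair_big_dep (fun i : 'I_m.+1 => (0 < i)%N)
  (fun i j : 'I_m.+1 => (i + j <= m)%N) (fun i j : 'I_m.+1 => F i.-1 j)) /=.
rewrite (exchange_big_dep xpredT) //= big_ord_recr /=.
(* Column [m] contains no cell, since rows start at 1. *)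
rewrite [X in _ * X]big1 ?mulr1; last by move=> i; lia.
apply: eq_bigr => j _; rewrite prod_ord_gt0 //=.
rewrite (big_ord_widen m (fun i => F i j)) ?leq_subr //.
by apply: eq_bigl => i; apply/idP/idP; rewrite /bump; lia.
Qed.

Lemma prod_cell_shift (R : comNzRingType) m (F : nat -> nat -> R) :
  (forall i, F i 0%N = 1) ->
  \prod_(p : cell m) F (cell_row p).-1 (cell_col p) =
  \prod_(j < m) \prod_(i < m - j.+1) F i j.+1.
Proof.
move=> F0; rewrite prod_cell; case: m => [|m]; first by rewrite !big_ord0.
rewrite big_ord_recl big1 // mul1r [RHS]big_ord_recr /= subnn big_ord0 mulr1.
by apply: eq_bigr => j _; apply: eq_bigr => i _.
Qed.

Lemma expr_card (R : comNzRingType) (T : finType) (P : pred T) (y : R) :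
  y ^+ #|[set p | P p]| = \prod_p y ^+ P p.
Proof. by rewrite prodrXr -sum1dep_card big_mkcond. Qed.

Section Stats.
Variables (n : nat) (a : array n).
Let f (i j : nat) : nat := entry a i j.

(** Outside column 0 the southwest neighbor exists and is unique, so the quantifier tests a single
    entry. *)
Lemma exists_southwest (p : cell n) (Q : nat -> bool) :
  [exists q : cell n, is_southwest p q && Q (a q)] =
  if cell_col p is j.+1 then Q (f (cell_row p).-1.+1 j) else false.
Proof.
have := cell_range p; case pc: (cell_col p) => [|j] /andP[p0 pm].
  by apply/existsP => -[q]; rewrite /is_southwest pc andbF.
have [q [qr qc]] : exists q : cell n, cell_row q = (cell_row p).+1 /\ cell_col q = j.
  by apply: cell_exists; lia.
apply/existsP/idP => [[r /andP[/andP[/eqP rr /eqP rc]]]|H].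
  by move: rc; rewrite pc => -[rc]; rewrite entryE rr -rc prednK.
by exists q; rewrite /is_southwest entryE qr qc pc !eqxx /= -(prednK p0).
Qed.

Lemma exists_west (p : cell n) (Q : nat -> bool) :
  [exists q : cell n, is_west p q && Q (a q)] =
  if cell_col p is j.+1 then Q (f (cell_row p).-1 j) else false.
Proof.
have := cell_range p; case pc: (cell_col p) => [|j] /andP[p0 pm].
  by apply/existsP => -[q]; rewrite /is_west pc andbF.
have [q [qr qc]] : exists q : cell n, cell_row q = (cell_row p).-1.+1 /\ cell_col q = j.
  by apply: cell_exists; lia.
apply/existsP/idP => [[r /andP[/andP[/eqP rr /eqP rc]]]|H].
  by move: rc; rewrite pc => -[rc]; rewrite entryE rr -rc.
by exists q; rewrite /is_west entryE qr qc pc prednK // !eqxx.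
Qed.

Lemma prod_stats (R : comNzRingType) (l : R) :
  l ^+ statE a * (1 + l) ^+ statN a =
  \prod_(j < n) \prod_(i < n - j.+1) entry_wt l (f i j) (f i.+1 j) (f i j.+1).
Proof.
rewrite /statE /statN !expr_card -big_split /=.
(* Column 0 counts in neither statistic, hence the factor 1. *)
pose F i j := if j is j'.+1 then entry_wt l (f i j') (f i.+1 j') (f i j) else 1.
transitivity (\prod_(p : cell n) F (cell_row p).-1 (cell_col p)).
  apply: eq_bigr => p _.
  have -> : [exists q : cell n, is_southwest p q && (a p == a q)] =
    [exists q : cell n, is_southwest p q && (a p == a q :> nat)].
    by apply: eq_existsb => q; rewrite val_eqE.
  rewrite (exists_southwest p (fun k => a p == k :> nat)).
  rewrite (exists_southwest p (fun k => a p < k)%N).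
  rewrite (exists_west p (fun k => k < a p)%N) entryE.
  by case: (cell_col p) => [|j]; rewrite ?expr0 ?mulr1.
exact: (@prod_cell_shift _ n F).
Qed.

End Stats.

(** * Specialization to polynomials and the bottom row 1, ..., n *)

Section Final.
Variable n : nat.

(* The value 0 at index 0 lets the sums defining [krylov] start at index 1. *)
Definition xval (k : nat) : {mpoly int[n.+1]} :=
  if k is k'.+1 then xvar (inord k) else 0.

Lemma xvalE (k : 'I_n.+1) : (0 < k)%N -> xval k = xvar k.
Proof. by rewrite /xval; case: k => -[//|k] /= kn _; congr xvar; apply/val_inj; rewrite /= inordK. Qed.

Lemma xvar_inj : injective (@xvar n).
Proof.
move=> i j /(congr1 (fun p => p@_U_(j)%MM)).
by rewrite /xvar !mcoeffX eqxx eq_mnm1; case: eqP.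
Qed.

Lemma xvar_neq0 (k : 'I_n.+1) : xvar k != 0.
Proof.
apply/eqP => /(congr1 (fun p => p@_U_(k)%MM)) /eqP.
by rewrite /xvar mcoeffX eqxx mcoeff0 oner_eq0.
Qed.

(** In column 0 the two bounds coincide and force the value. Conversely the bounds propagate by
    induction on the column: the lower one from the west neighbor, the upper one from the southwest
    neighbor. *)
Lemma in_Ybyog (a : array n) :
  (a \in Ybyog n) = monotone a && [forall i : 'I_n, entry a i 0 == inord i.+1].
Proof.
rewrite inE -/(monotone a).
have inordV (i : 'I_n) : (inord i.+1 : 'I_n.+1) = i.+1 :> nat by rewrite inordK // ltnS.
apply/idP/idP => /andP[].
  move=> /forallP r g; rewrite g /=; apply/forallP => i.
  have [|p [pr pc]] := @cell_exists n i 0; first by rewrite addn0.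
  have := r p; rewrite entryE pr pc addn0 /= => ri.
  by apply/eqP/val_inj; rewrite /= inordV; apply/eqP; rewrite eqn_leq andbC.
move=> g /forallP b; rewrite g andbT; apply/forallP => p; rewrite entryE.
have := cell_range p; case: (cell_row p) => // i /andP[_]; move: (cell_col p) => j ijn /=.
have {}b k : (k < n)%N -> entry a k 0 = k.+1 :> nat.
  by move=> kn; rewrite (eqP (b (Ordinal kn))) (inordV (Ordinal kn)).
move/monotoneP: g => g.
elim: j i ijn => [|j IH] i ijn; first by rewrite b ?addn0 ?leqnn //; lia.
have [|_ /andP[h1 h2]] := g i j; first lia.
have /andP[h3 _] : (i < entry a i j <= i.+1 + j)%N by apply: IH; lia.
have /andP[_ h4] : (i.+1 < entry a i.+1 j <= i.+2 + j)%N by apply: IH; lia.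
apply/andP; split; [exact: leq_trans h3 h1|apply: leq_trans h2 _; lia].
Qed.

(** Grouping the cells by value gives [xvar k ^+ statC k a]. The extra factor [xvar k] undoes the
    subtraction of 1, because column 0 contains [k]. *)
Lemma prod_statC (a : array n) : a \in Ybyog n ->
  (\prod_(k < n.+1 | (0 < k)%N) xvar k) *
    \prod_(k < n.+1 | (0 < k)%N) xvar k ^+ (statC k a - 1) =
  \prod_(j < n) \prod_(i < n - j) xval (entry a i j).
Proof.
move=> Ya; have apos p : (0 < a p)%N.
  move: Ya; rewrite inE => /andP[/forallP/(_ p)/andP[h _] _].
  by apply: leq_trans h; case/andP: (cell_range p).
rewrite -big_split -(prod_cell n (fun i j => xval (entry a i j))) /=.
transitivity (\prod_(p : cell n) xvar (a p)); last first.
  by apply: eq_bigr => p _; rewrite -entryE xvalE.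
rewrite (partition_big a (fun k : 'I_n.+1 => (0 < k)%N)) //=.
apply: eq_bigr => k k0.
rewrite -exprS subn1 prednK; last first.
  have [|p [pr pc]] := @cell_exists n k.-1 0; first by have := ltn_ord k; lia.
  apply/card_gt0P; exists p; rewrite inE entryE pr pc /=.
  move: Ya; rewrite in_Ybyog => /andP[_ /forallP b].
  have kn : (k.-1 < n)%N by have := ltn_ord k; lia.
  by rewrite (eqP (b (Ordinal kn))) /= inordK prednK.
rewrite /statC expr_card [RHS]big_mkcond; apply: eq_bigr => p _.
by rewrite val_eqE; case: eqP => [->|_]; rewrite ?expr1 ?expr0.
Qed.

Lemma krylov_shift (R : comNzRingType) (l : R) (x : nat -> R) j v :
  x 0%N = 0 -> krylov l x j v.+1 = krylov l (fun k => x k.+1) j v.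
Proof.
move=> x0; elim: j v => [//|j IH] v /=.
rewrite big_ord_recl x0 mul0r mulr0 add0r IH; congr (_ + _).
by apply: eq_bigr => c _; rewrite lift0 IH.
Qed.

End Final.

(* The truncated subtraction in the exponent is never truncating: for a in
   [Ybyog n] the entry in row k, column 0 equals k, so statC k a >= 1. *)
Theorem theorem18 (n : nat) (hn : (1 <= n)%N) :
  \prod_(i < n.+1 | (1 <= i)%N) \prod_(j < n.+1 | (i < j)%N)
     (xvar i + lam n * xvar j)
  = \sum_(a in Ybyog n)
      lam n ^+ statE a * (1 + lam n) ^+ statN a *
      \prod_(k < n.+1 | (1 <= k)%N) xvar k ^+ (statC k a - 1).
Proof.
have P0 : \prod_(k < n.+1 | (0 < k)%N) @xvar n k != 0.
  by apply/prodf_neq0 => k _; apply: xvar_neq0.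
(* Multiplying by all the x_k completes the summands to [tri_wt] and matches the prefactor of the
   determinant in [sum_monotone]. *)
apply: (mulfI P0); rewrite big_distrr /=.
transitivity (\sum_(a : tri n n | monotone a && [forall i : 'I_n, entry a i 0 == inord i.+1])
    tri_wt (lam n) (@xval n) n (entry a)); last first.
  apply: eq_big => [a|a Ya]; first by rewrite in_Ybyog.
  by rewrite mulrCA prod_statC ?in_Ybyog // prod_stats mulrC.
rewrite (@sum_monotone n _ (lam n) (@xval n) n (fun i => inord i.+1)); last first.
  by move=> i im; rewrite !inordK; lia.
rewrite prod_ord_gt0 //=; congr (_ * _).
  by apply: eq_bigr => i _; rewrite -xvalE //= inordK // ltnS.
(* Since [xval 0 = 0], the base 1, ..., n can be shifted to 0, ..., n - 1, as [det_krylovmx]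
   requires. *)
rewrite (_ : krylovmx _ _ _ _ = krylovmx (lam n) (fun k => @xval n k.+1) n id); last first.
  by apply/matrixP => i j; rewrite !mxE inordK ?krylov_shift // ltnS.
rewrite det_krylovmx; last first.
- move=> i j ijn; apply/eqP => /xvar_inj /(congr1 val) /=.
  by rewrite !inordK; lia.
- exact: xvar_neq0.
rewrite prod_ord_gt0 //= [RHS](exchange_big_dep xpredT) //=.
apply: eq_bigr => i _; rewrite prod_ord_gt0 //=.
by apply: eq_bigr => j _; congr (xvar _ + _ * xvar _); apply/val_inj; rewrite /= inordK // ltnS.
Qed.
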